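(* Let $n\ge 2$ and $k,\ell\ge 0$ be integers, and let $i$ be a vertex of $K_n$. Then $(K_n,i)$ allows the nullity pair $(k,\ell)$ with the SNIP if and only if either ($|k-\ell|\le 1$ and $\ell\le n-2$) or $(k,\ell)=(0,1)$. Moreover, every matrix $A\in\mathcal{S}(K_n)$ has the $i$-SNIP.
   Context: All matrices are real. For a simple graph $G$ on $[n]$, $\mathcal{S}(G)$ is the set of real symmetric $n\times n$ matrices whose off-diagonal $(j,k)$ entry is nonzero iff $\{j,k\}\in E(G)$ (diagonal free). $A(i)$ is $A$ with row and column $i$ deleted. $A$ has the $i$-SNIP if $X=O$ is the only real symmetric $X$ with $A\circ X=O$, $I\circ X=O$ and $(AX)(i,:]=O$ ($AX$ with row $i$ deleted). $(G,i)$ allows $(k,\ell)$ with the SNIP if some $A\in\mathcal{S}(G)$ with the $i$-SNIP has $(\operatorname{null}(A),\operatorname{null}(A(i)))=(k,\ell)$. *)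

(* Defs.v *)
From HB Require Import structures.
From mathcomp Require Export all_boot all_order all_algebra.
From mathcomp Require Export reals.

Set Implicit Arguments.
Unset Strict Implicit.
Unset Printing Implicit Defensive.

Import GRing.Theory Num.Theory.
Local Open Scope ring_scope.

Record sgraph (n : nat) := SGraph {
  adj :> rel 'I_n;
  adj_sym : symmetric adj;
  adj_irr : irreflexive adj
}.

Lemma complete_adj_sym n : symmetric [rel x y : 'I_n | x != y].
Proof. by move=> x y; rewrite /= eq_sym. Qed.

Lemma complete_adj_irr n : irreflexive [rel x y : 'I_n | x != y].
Proof. by move=> x; rewrite /= eqxx. Qed.

Definition complete_graph (n : nat) : sgraph n :=
  SGraph (@complete_adj_sym n) (@complete_adj_irr n).

Section Matrices.
Variable R : realType.

Definition hadamard (m n : nat) (A B : 'M[R]_(m, n)) : 'M[R]_(m, n) :=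
  \matrix_(i, j) (A i j * B i j).

(* Vectors are columns: the rows of kermx A^T span the transposes of the
   v such that A *m v = 0. *)
Definition nullity (m n : nat) (A : 'M[R]_(m, n)) : nat := \rank (kermx A^T).

Definition del_rowcol (n : nat) (i : 'I_n) (A : 'M[R]_n) : 'M[R]_n.-1 :=
  row' i (col' i A).

Definition in_S (n : nat) (G : sgraph n) (A : 'M[R]_n) : Prop :=
  A^T = A /\ forall j k : 'I_n, j != k -> (A j k != 0) = G j k.

Definition has_SNIP (n : nat) (i : 'I_n) (A : 'M[R]_n) : Prop :=
  forall X : 'M[R]_n,
    X^T = X -> hadamard A X = 0 -> hadamard 1%:M X = 0 ->
    row' i (A *m X) = 0 -> X = 0.

Definition allows_with_SNIP (n : nat) (G : sgraph n) (i : 'I_n) (k l : nat)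
    : Prop :=
  exists A : 'M[R]_n,
    [/\ in_S G A, has_SNIP i A & (nullity A, nullity (del_rowcol i A)) = (k, l)].

End Matrices.

Arguments allows_with_SNIP R {n} G i k l.

(* Main.v *)
(** Deleting a row and a column lowers the rank by at most two, which gives
    |k - l| <= 1; and l = n - 1 forces A(i) = 0, hence n = 2 and A invertible.
    Conversely, let J be the all-ones matrix and let M be a symmetric
    nonnegative matrix whose row s, with s <> i, is the s-th unit vector. Then
    J + M - E_ss lies in S(K_n) and is congruent to M, and the same congruence
    is available after deleting i. Taking for M a 0/1 diagonal matrix gives
    rank A - rank A(i) = 0 or 1; a diagonal matrix times a transposition moving
    i gives 2. *)

Require Import Defs.
From mathcomp Require Import all_boot all_order all_algebra.
From mathcomp Require Import perm zify.
From mathcomp Require Import reals.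

Set Implicit Arguments.
Unset Strict Implicit.
Unset Printing Implicit Defensive.

Import GRing.Theory Num.Theory.
Local Open Scope ring_scope.

(** * Ranks of diagonal matrices and of the all-ones matrix plus a perturbation *)

Lemma mxrank_diag_le (F : fieldType) n (d : 'rV[F]_n) :
  (\rank (diag_mx d) <= \sum_j (d 0%R j != 0%R))%N.
Proof.
rewrite diag_mx_sum_delta.
apply: (big_ind2 (fun (M : 'M_n) x => (\rank M <= x)%N)) => [|M x N y hM hN|j _].
- by rewrite mxrank0.
- exact: leq_trans (mxrank_add M N) (leq_add hM hN).
- have [->|nz] := eqVneq; first by rewrite scale0r mxrank0.
  by rewrite (leq_trans (mxrank_scale _ _)) ?mxrank_delta.
Qed.

(* The identity is diag(d) * diag(d^-1) plus the indicator of the zeros of d,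
   so subadditivity of the rank bounds rank (diag d) from below. *)
Lemma mxrank_diag (F : fieldType) n (d : 'rV[F]_n) :
  \rank (diag_mx d) = (\sum_j (d 0%R j != 0%R))%N.
Proof.
apply/eqP; rewrite eqn_leq mxrank_diag_le /=.
pose z : 'rV[F]_n := \row_j (d 0 j == 0)%:R.
have eq1 : 1%:M = diag_mx d *m diag_mx (\row_j (d 0 j)^-1) + diag_mx z.
  apply/matrixP=> j k; rewrite mul_diag_mx !mxE.
  have [->|_] := eqVneq j k; rewrite ?mulr0n ?mulr0 ?addr0 //.
  by have [->|nz] := eqVneq (d 0 k) 0; rewrite ?mul0r ?add0r // mulfV // addr0.
have : (n <= \rank (diag_mx d) + \rank (diag_mx z))%N.
  rewrite -[X in (X <= _)%N](mxrank1 F) eq1 (leq_trans (mxrank_add _ _)) //.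
  by rewrite leq_add2r mxrankM_maxl.
move/leq_trans/(_ (leq_add (leqnn _) (mxrank_diag_le z))).
have -> : (\sum_j (z 0%R j != 0%R) = \sum_j (d 0%R j == 0%R))%N.
  by apply: eq_bigr => j _; rewrite mxE; case: (d 0 j == 0); rewrite ?oner_eq0 ?eqxx.
have : (\sum_j (d 0%R j != 0%R) + \sum_j (d 0%R j == 0%R) = n)%N.
  rewrite -big_split /= -[RHS]card_ord -sum1_card.
  by apply: eq_bigr => j _; case: eqP.
move: (\sum_j (d 0%R j != 0%R))%N (\sum_j (d 0%R j == 0%R))%N => a b; lia.
Qed.

(* Congruence by the unipotent matrix whose row s consists of ones turns
   E_ss into the all-ones matrix and fixes P. *)
Lemma mxrank_const_add (F : fieldType) n (s : 'I_n) (P : 'M[F]_n) :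
  row s P = 0 -> col s P = 0 ->
  \rank (const_mx 1 + P)%R = \rank (delta_mx s s + P)%R.
Proof.
move=> /rowP rP /colP cP.
have {}rP k : P s k = 0 by have := rP k; rewrite !mxE.
have {}cP k : P k s = 0 by have := cP k; rewrite !mxE.
pose N : 'M[F]_n := \matrix_(x, y) ((x == s) && (y != s))%:R.
(* Only row [s] of [N] is nonzero and its entry at [s] is 0, so [N] squares to zero and [1 - N]
   inverts [U]. *)
have NN : N *m N = 0.
  apply/matrixP=> x y; rewrite !mxE big1 // => z _; rewrite !mxE.
  by case: (z == s); rewrite ?andbF ?mul0r ?mulr0.
have PN : P *m N = 0.
  apply/matrixP=> x y; rewrite !mxE big1 // => z _; rewrite !mxE.
  by case: eqP => [->|]; rewrite ?cP ?mul0r ?mulr0.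
have NP : N^T *m P = 0.
  apply/matrixP=> x y; rewrite !mxE big1 // => z _; rewrite !mxE.
  by case: eqP => [->|]; rewrite ?rP ?mul0r ?mulr0.
pose U := 1%:M + N.
have tU : U^T = 1%:M + N^T by rewrite raddfD /= tr_scalar_mx.
have uU : U \in unitmx.
  suff /mulmx1_unit [] : U *m (1%:M - N) = 1%:M by [].
  by rewrite mulmxBr mulmx1 /U mulmxDl mul1mx NN addr0 addrK.
have rU : delta_mx (0 : 'I_1) s *m U = const_mx 1.
  by rewrite -rowE; apply/rowP=> y; rewrite !mxE eqxx /=; case: eqVneq;
    rewrite ?eqxx ?addr0 ?add0r // eq_sym => /negPf ->.
have cU : U^T *m delta_mx s (0 : 'I_1) = const_mx 1.
  by apply: trmx_inj; rewrite trmx_mul trmxK trmx_delta rU trmx_const.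
have -> : const_mx 1 + P = U^T *m (delta_mx s s + P) *m U.
  (* Split [E_ss] as a unit column times a unit row; [U^T] and [U] turn these into all-ones vectors,
     whose product is the all-ones matrix. *)
  rewrite -(mul_delta_mx (0 : 'I_1)).
  rewrite mulmxDr mulmxDl mulmxA cU -mulmxA rU; congr (_ + _).
    by apply/matrixP=> x y; rewrite !mxE big_ord1 !mxE mulr1.
  by rewrite tU mulmxDl mul1mx NP addr0 mulmxDr mulmx1 PN addr0.
rewrite mxrankMfree ?row_free_unit //.
by rewrite -mxrank_tr trmx_mul trmxK mxrankMfree ?row_free_unit // mxrank_tr.
Qed.

(** * Rank and nullity under deletion of a row and a column *)

Lemma mxrank_row'_bounds (F : fieldType) m n (i : 'I_m) (A : 'M[F]_(m, n)) :
  (\rank (row' i A) <= \rank A <= (\rank (row' i A)).+1)%N.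
Proof.
rewrite {1}row'Esub mxrankS ?rowsub_sub //=.
have sA : (A <= row i A + row' i A)%MS.
  apply/row_subP=> j; case: (unliftP i j) => [k|] ->.
    by rewrite (submx_trans _ (addsmxSr _ _)) // -row_rowsub -row'Esub row_sub.
  exact: addsmxSl.
apply: leq_trans (mxrankS sA) _; apply: leq_trans (mxrank_adds_leqif _ _) _.
exact: leq_add (rank_leq_row _) (leqnn _).
Qed.

Lemma mxrank_del_rowcol_bounds (R : realType) n (i : 'I_n) (A : 'M[R]_n) :
  (\rank (del_rowcol i A) <= \rank A <= (\rank (del_rowcol i A)).+2)%N.
Proof.
have := mxrank_row'_bounds i (col' i A); have := mxrank_row'_bounds i A^T.
rewrite -[row' i A^T]trmxK mxrank_tr tr_row' trmxK mxrank_tr.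
move=> /andP[h1 h2] /andP[h3 h4]; rewrite (leq_trans h3 h1) /=.
by apply: leq_trans h2 _; rewrite ltnS.
Qed.

Lemma nullityE (R : realType) m n (A : 'M[R]_(m, n)) :
  nullity A = (n - \rank A)%N.
Proof. by rewrite /nullity mxrank_ker mxrank_tr. Qed.

(** * The SNIP for complete graphs, and necessity of the conditions *)

Lemma complete_graph_has_SNIP (R : realType) n (i : 'I_n) (A : 'M[R]_n) :
  in_S (complete_graph n) A -> has_SNIP i A.
Proof.
move=> [_ offA] X _ /matrixP AX /matrixP IX _; apply/matrixP=> j k.
have := AX j k; have := IX j k; rewrite !mxE.
have [->|njk _ /eqP] := eqVneq j k; first by rewrite mul1r.
by rewrite mulf_eq0 (negPf (_ : A j k != 0)) ?offA //= => /eqP.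
Qed.

(** With [A j j = 0] the determinant is [-(A i j)^2], which is nonzero; the proof solves [v A = 0]
    directly, column [j] first. *)
Lemma nullity_order2_hollow_minor (R : realType) (i : 'I_2) (A : 'M[R]_2) :
  in_S (complete_graph 2) A -> del_rowcol i A = 0 -> nullity A = 0%N.
Proof.
move=> [symA offA] /matrixP /(_ 0 0); rewrite !mxE => A0.
pose j := lift i (0 : 'I_1).
have nz : A i j != 0 by rewrite offA //= neq_lift.
have Aji : A j i = A i j by rewrite -{1}symA mxE.
suff /eqP frA : row_free A by rewrite nullityE frA.
apply: inj_row_free => v /rowP vA.
have sum2 (f : 'I_2 -> R) : \sum_k f k = f i + f j.
  by rewrite (bigD1_ord i) //= big_ord1.
have vi : v 0 i = 0.
  apply/eqP; move: (vA j); rewrite !mxE sum2 A0 mulr0 addr0 => /eqP.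
  by rewrite mulf_eq0 (negPf nz) orbF.
have vj : v 0 j = 0.
  apply/eqP; move: (vA i); rewrite !mxE sum2 vi mul0r add0r Aji => /eqP.
  by rewrite mulf_eq0 (negPf nz) orbF.
apply/rowP=> k; rewrite mxE; case: (unliftP i k) => [x|] -> //.
by rewrite [x]ord1.
Qed.

Lemma complete_graph_nullity_pair (R : realType) n (i : 'I_n.+2) (A : 'M[R]_n.+2) :
  in_S (complete_graph n.+2) A ->
  let k := nullity A in let l := nullity (del_rowcol i A) in
  (`|k%:Z - l%:Z| <= 1 /\ (l <= n)%N) \/ (k, l) = (0%N, 1%N).
Proof.
move=> SA k l; have := mxrank_del_rowcol_bounds i A.
have := rank_leq_row A; have := rank_leq_row (del_rowcol i A).
have ek : k = (n.+2 - \rank A)%N by rewrite /k nullityE.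
have el : l = (n.+1 - \rank (del_rowcol i A))%N by rewrite /l nullityE.
(* A rank drop of [d] gives [k - l = 1 - d] with [d] in {0, 1, 2}; a positive rank of the minor
   gives [l <= n]. *)
have [r0|] := posnP (\rank (del_rowcol i A)); last by lia.
move/eqP: r0; rewrite mxrank_eq0 => /eqP D0.
(* A minor of order at least 2 has nonzero off-diagonal entries, so it cannot vanish. *)
case: n => [|n] in i A SA k l ek el D0 *; last first.
  have /matrixP/(_ 0 1) := D0; rewrite !mxE => /eqP.
  by rewrite (negPf (_ : A _ _ != 0)) //; case: SA => _ ->; rewrite /= (inj_eq lift_inj).
move=> _ _ _; right; congr pair; first exact: nullity_order2_hollow_minor D0.
by rewrite el D0 mxrank0.
Qed.

(** * Matrices realizing prescribed ranks *)

Lemma sum_ltn_ord m r : (r <= m)%N -> (\sum_(j < m) (j < r) = r)%N.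
Proof.
move=> hr; transitivity (\sum_(j < m | j < r) 1)%N.
  by rewrite [RHS]big_mkcond; apply: eq_bigr => j _; case: ltnP.
by rewrite (big_ord_narrow hr) sum1_card card_ord.
Qed.

Lemma complete_graph_witness (R : realType) n (i : 'I_n.+1) (s : 'I_n)
    (M : 'M[R]_n.+1) :
  M^T = M -> (forall x y, 0 <= M x y) ->
  (forall x, M (lift i s) x = (x == lift i s)%:R) ->
  exists A : 'M[R]_n.+1,
    [/\ in_S (complete_graph n.+1) A, \rank A = \rank M
      & \rank (del_rowcol i A) = \rank (del_rowcol i M)].
Proof.
move=> symM M_ge0 Ms; set z := lift i s in Ms *.
have Ms' x : M x z = (x == z)%:R by rewrite -[M]symM mxE Ms.
exists (const_mx 1 + (M - delta_mx z z)); split.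
- split=> [|j k njk]; first by rewrite !raddfD raddfN /= symM trmx_const trmx_delta.
  rewrite /= njk !mxE.
  have -> : (j == z) && (k == z) = false.
    by apply: contraNF njk => /andP[/eqP -> /eqP ->].
  by rewrite subr0 lt0r_neq0 // ltr_wpDr.
(* Row and column [z] of [M - E_zz] vanish, so the all-ones matrix may be traded for [E_zz], which
   restores [M]. *)
- rewrite (@mxrank_const_add _ _ z) ?subrKC //.
    by apply/rowP=> x; rewrite !mxE Ms eqxx subrr.
  by apply/colP=> x; rewrite !mxE Ms' eqxx andbT subrr.
(* Since [z] differs from [i], the minor has the same shape, with [s] as the index of [z] after
   deletion. *)
have -> : del_rowcol i (const_mx 1 + (M - delta_mx z z)) =
          const_mx 1 + (del_rowcol i M - delta_mx s s).
  by apply/matrixP=> x y; rewrite !mxE !(inj_eq lift_inj).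
rewrite (@mxrank_const_add _ _ s) ?subrKC //.
  by apply/rowP=> x; rewrite !mxE Ms (inj_eq lift_inj) eqxx subrr.
by apply/colP=> x; rewrite !mxE Ms' (inj_eq lift_inj) eqxx andbT subrr.
Qed.

Definition initial_row (R : realType) m r : 'rV[R]_m := \row_j (j < r)%:R.

Lemma mxrank_diag_initial (R : realType) m r :
  (r <= m)%N -> \rank (diag_mx (initial_row R m r)) = r.
Proof.
move=> hr; rewrite mxrank_diag -[RHS](sum_ltn_ord hr).
by apply: eq_bigr => j _; rewrite mxE pnatr_eq0 eqb0 negbK.
Qed.

(** This is [initial_row] with the entry [a] inserted at position [i], so that deleting [i] recovers
    [initial_row]. *)
Definition bordered_row (R : realType) n (i : 'I_n.+1) r (a : bool) : 'rV[R]_n.+1 :=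
  \row_x (oapp (fun j : 'I_n => (j < r)%N) a (unlift i x))%:R.

Lemma mxrank_diag_bordered (R : realType) n (i : 'I_n.+1) r a :
  (r <= n)%N -> \rank (diag_mx (bordered_row R i r a)) = (a + r)%N.
Proof.
move=> hr; rewrite mxrank_diag (bigD1_ord i) //= mxE unlift_none /=.
rewrite pnatr_eq0 eqb0 negbK -[in RHS](sum_ltn_ord hr); congr (_ + _)%N.
by apply: eq_bigr => j _; rewrite mxE liftK pnatr_eq0 eqb0 negbK.
Qed.

Lemma complete_graph_small_bordering (R : realType) n (i : 'I_n.+1) r (a : bool) :
  (0 < r <= n)%N ->
  exists A : 'M[R]_n.+1,
    [/\ in_S (complete_graph n.+1) A, \rank A = (a + r)%N
      & \rank (del_rowcol i A) = r].
Proof.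
(* The index [r - 1] is the last one carrying a diagonal 1; it exists because [r] is positive. *)
move=> /andP[r0 rn]; have s_lt : (r.-1 < n)%N by lia.
pose M := diag_mx (bordered_row R i r a).
have [||x|A [SA rA rD]] := @complete_graph_witness R n i (Ordinal s_lt) M.
- exact: tr_diag_mx.
- by move=> x y; rewrite !mxE; case: eqP => _; rewrite ?mulr1n ?mulr0n ?ler0n.
- by rewrite !mxE liftK /= prednK // leqnn eq_sym.
exists A; split=> //; first by rewrite rA mxrank_diag_bordered.
rewrite rD -[RHS](mxrank_diag_initial R rn); congr (\rank _).
by apply/matrixP=> x y; rewrite !mxE liftK (inj_eq lift_inj).
Qed.

Lemma complete_graph_large_bordering (R : realType) n (i : 'I_n.+1) r :
  (0 < r < n)%N ->
  exists A : 'M[R]_n.+1,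
    [/\ in_S (complete_graph n.+1) A, \rank A = r.+2
      & \rank (del_rowcol i A) = r].
Proof.
move=> /andP[r0 rn]; have s_lt : (r.-1 < n)%N by lia.
(* Rows [i] and [t] of [M] are the unit vectors at [t] and [i]. Deleting [i] kills row and column
   [t], leaving [r] ones out of rank [r + 2]. *)
pose t := lift i (Ordinal rn); pose d := bordered_row R i r.+1 true.
pose M := diag_mx d *m tperm_mx i t.
have ME x y : M x y = d 0 x * (tperm i t x == y)%:R by rewrite /M mul_diag_mx !mxE.
have di : d 0 i = 1 by rewrite mxE unlift_none.
have dl j : d 0 (lift i j) = (j < r.+1)%:R by rewrite mxE liftK.
have dt : d 0 t = 1 by rewrite dl ltnSn.
(* Invariance of [d] under the transposition makes [M] symmetric. *)
have dtau x : d 0 (tperm i t x) = d 0 x by case: tpermP => [->|->|]; rewrite ?di ?dt.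
have [||x|A [SA rA rD]] := @complete_graph_witness R n i (Ordinal s_lt) M.
- apply/matrixP=> x y; rewrite mxE !ME.
  have [<-|nyx] := eqVneq (tperm i t y) x; first by rewrite tpermK eqxx dtau.
  by rewrite -(inj_eq (@perm_inj _ (tperm i t))) tpermK eq_sym (negPf nyx) !mulr0.
- by move=> x y; rewrite ME mxE mulr_ge0 ?ler0n.
- rewrite ME dl tpermD ?neq_lift //=; last first.
    by rewrite (inj_eq lift_inj) -val_eqE /=; lia.
  by rewrite eq_sym (_ : (r.-1 < r.+1)%N) ?mul1r //; lia.
exists A; split=> //.
  by rewrite rA mxrankMfree ?row_free_unit ?unitmx_perm // mxrank_diag_bordered.
rewrite rD -[RHS](mxrank_diag_initial R (ltnW rn)); congr (\rank _).
apply/matrixP=> x y; rewrite mxE [LHS]mxE ME dl !mxE.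
have [xr|nxr] := eqVneq (x : nat) r.
  have -> : lift i x = t by congr lift; apply: val_inj.
  by rewrite tpermR (negPf (neq_lift _ _)) mulr0 xr ltnn mul0rn.
rewrite tpermD ?neq_lift //; last by rewrite eq_sym (inj_eq lift_inj).
rewrite (inj_eq lift_inj) ltnS leq_eqVlt (negPf nxr).
by rewrite mulr_natr.
Qed.

Lemma complete_graph_rank_pair_exists (R : realType) n (i : 'I_n.+1) r q :
  (0 < r <= n)%N -> (r <= q <= r.+2)%N -> (q <= n.+1)%N ->
  exists A : 'M[R]_n.+1,
    [/\ in_S (complete_graph n.+1) A, \rank A = q & \rank (del_rowcol i A) = r].
Proof.
move=> hr hq hn; have [e|[e|e]] : q = r \/ q = r.+1 \/ q = r.+2 by lia.
- by rewrite e; apply: (complete_graph_small_bordering R i false hr).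
- by rewrite e; apply: (complete_graph_small_bordering R i true hr).
- by rewrite e; apply: complete_graph_large_bordering; lia.
Qed.

(** * From rank pairs back to nullity pairs *)

Theorem proposition4p3 (R : realType) (n : nat) (hn : (2 <= n)%N) (i : 'I_n) :
  (forall k l : nat,
     allows_with_SNIP R (complete_graph n) i k l <->
     ((`|k%:Z - l%:Z| <= 1 /\ (l <= n - 2)%N) \/ (k, l) = (0%N, 1%N))) /\
  (forall A : 'M[R]_n, in_S (complete_graph n) A -> has_SNIP i A).
Proof.
split; last by move=> A; apply: complete_graph_has_SNIP.
case: n => [|[|n]] // in hn i *; rewrite !subSS subn0 => k l; split.
  by move=> [A [SA _ [<- <-]]]; apply: complete_graph_nullity_pair.
(* The order is now [n + 2]: for [n > 0] the pair (0, 1) already satisfies the inequalities, so it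
   is exceptional only at order 2. *)
move=> kl; have [[d_kl ln]|[n0 k0 l1]] :
    (`|k%:Z - l%:Z| <= 1 /\ (l <= n)%N) \/ [/\ n = 0%N, k = 0%N & l = 1%N].
- case: kl => [|[-> ->]]; first by left.
  by case: (n) => [|m]; [right | left].
- have [||| A [SA rA rD]] :=
    @complete_graph_rank_pair_exists R n.+1 i (n.+1 - l) (n.+2 - k); try lia.
  exists A; split=> //; first exact: complete_graph_has_SNIP.
  by rewrite !nullityE rA rD; congr pair; lia.
(* At order 2, the zero diagonal makes the minor at [i] vanish. *)
subst; pose A : 'M[R]_2 := const_mx 1 - 1%:M.
have SA : in_S (complete_graph 2) A.
  split=> [|x y nxy]; first by rewrite raddfB /= trmx_const tr_scalar_mx.
  by rewrite !mxE /= nxy (negPf nxy) subr0 oner_eq0.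
have D0 : del_rowcol i A = 0.
  by apply/matrixP=> x y; rewrite !ord1 !mxE eqxx subrr.
exists A; split=> //; first exact: complete_graph_has_SNIP.
by rewrite (nullity_order2_hollow_minor SA D0) D0 nullityE mxrank0.
Qed.
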